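(* Let $n,m\in\mathbb{N}$ with $2^{25}\le m\le n$. Then $$R(Q_m,Q_n)\le n\left(m-\Big(1-\tfrac{2}{\sqrt{\log m}}\Big)\log m\right).$$ Moreover, if $n,m\in\mathbb{N}$ with $n\ge m$ and $\varepsilon\in\mathbb{R}$, $0<\varepsilon<1$, are such that $$\frac{n+m}{n}\cdot\frac{1}{(1-\varepsilon)\log m}+m^{-\varepsilon}\le\varepsilon,$$ then $$R(Q_m,Q_n)\le n\big(m-(1-\varepsilon)^2\log m\big).$$
   Context: $\log$ denotes the logarithm with base $2$. For posets $P$ and $Q$, an (induced) copy of $P$ in $Q$ is the image of an injective map $\phi\colon P\to Q$ such that for all $X,Y\in P$, $X\le_P Y$ if and only if $\phi(X)\le_Q\phi(Y)$. $Q_n$ denotes the Boolean lattice of dimension $n$, i.e. the poset of all subsets of an $n$-element set ordered by inclusion. A blue/red coloring of a poset assigns to each of its elements the color blue or red; a subposet is blue (red) if all its elements are blue (red). The poset Ramsey number $R(P,Q)$ is the least $N\in\mathbb{N}$ such that every blue/red coloring of the elements of $Q_N$ contains a blue induced copy of $P$ or a red induced copy of $Q$. *)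

(* Defs.v *)
From mathcomp Require Import all_boot all_order all_algebra.
From mathcomp Require Import boolp reals exp.

Set Implicit Arguments.
Unset Strict Implicit.
Unset Printing Implicit Defensive.

Import Order.TTheory GRing.Theory Num.Theory.

(* {set 'I_n} is ordered by inclusion through the instances exported here. *)
Export Order.DefaultSetSubsetOrder.

Notation boolean_lattice n := {set 'I_n} (only parsing).

Section PosetRamsey.
Local Open Scope order_scope.

Definition induced_embedding d d' (P : porderType d) (Q : porderType d')
    (phi : P -> Q) : Prop :=
  injective phi /\ forall x y : P, (x <= y) <-> (phi x <= phi y).

Definition has_mono_copy d d' (P : porderType d) (Q : porderType d')
    (c : Q -> bool) (b : bool) : Prop :=
  exists phi : P -> Q, induced_embedding phi /\ forall x, c (phi x) = b.

(* A coloring is a map to bool, where true stands for blue, false for red. *)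
Definition ramsey_arrow d d' (P : finPOrderType d) (Q : finPOrderType d')
    (N : nat) : Prop :=
  forall c : boolean_lattice N -> bool,
    has_mono_copy P c true \/ has_mono_copy Q c false.

Section Existence.
Variables (d d' : Order.disp_t) (P : finPOrderType d) (Q : finPOrderType d').

Let T : finType := (P + 'I_#|P|.+1 * Q)%type.
Let rk (x : P) : nat := #|[set p : P | p < x]|.

Let rk_le x : (rk x < #|P|.+1)%N.
Proof. by rewrite ltnS max_card. Qed.

Let rk_lt x y : x < y -> (rk x < rk y)%N.
Proof.
move=> xy; apply: proper_card; apply/properP; split.
  by apply/subsetP => p; rewrite !inE => /lt_trans; apply.
by exists x; rewrite !inE ?ltxx.
Qed.

Let psi (x : P) (y : Q) : {set T} := [set t : T | match t with
  | inl p => p <= x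
  | inr (i, q) => (i < rk x)%N || ((i == rk x :> nat) && (q <= y)) end].

Let psi_red x y y' : (psi x y \subset psi x y') = (y <= y').
Proof.
apply/subsetP/idP => [H|yy' [p|[i q]]]; rewrite ?inE //.
  have := H (inr (Ordinal (rk_le x), y)).
  by rewrite !inE /= ltnn eqxx lexx /=; apply.
case/orP => [->//|/andP[-> qy]] /=.
by rewrite (le_trans qy yy') orbT.
Qed.

Let psi_blue (g : P -> Q) x x' :
  (psi x (g x) \subset psi x' (g x')) = (x <= x').
Proof.
apply/subsetP/idP => [H|].
  by have := H (inl x); rewrite !inE lexx; apply.
rewrite le_eqVlt => /orP[/eqP-> //|xx'] [p|[i q]]; rewrite !inE.
  by move=> px; apply: le_trans px (ltW xx').
case/orP => [ix|/andP[/eqP-> _]]; last by rewrite rk_lt.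
by rewrite (ltn_trans ix (rk_lt xx')).
Qed.

Let tr (A : {set T}) : boolean_lattice #|T| := enum_rank @: A.

Let trS A B : (tr A <= tr B) = (A \subset B).
Proof.
change (tr A \subset tr B = (A \subset B)); apply/subsetP/subsetP => H t.
  by move=> tA; have := H (enum_rank t); rewrite !(mem_imset _ _ enum_rank_inj); apply.
by case/imsetP => u uA ->; rewrite (mem_imset _ _ enum_rank_inj) H.
Qed.

Let embed_mono e (S : porderType e) (f : S -> boolean_lattice #|T|) :
  (forall x y, (f x <= f y) = (x <= y)) -> induced_embedding f.
Proof.
move=> H; split=> [x y fxy|x y]; last by rewrite H.
by apply/le_anti; rewrite -!H fxy lexx.
Qed.

Lemma ramsey_arrow_exists : exists N, `[< ramsey_arrow P Q N >].
Proof.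
exists #|T|; apply/asboolP => c.
case: (boolP [exists x, forall y, ~~ c (tr (psi x y))]).
  case/existsP => x /forallP H; right; exists (fun y => tr (psi x y)).
  split; last by move=> y; apply/negbTE.
  by apply: embed_mono => y y'; rewrite trS psi_red.
rewrite negb_exists => /forallP H; left.
have /fin_all_exists[g Hg] : forall x, exists y, c (tr (psi x y)).
  by move=> x; have := H x; rewrite negb_forall => /existsP[y /negPn]; exists y.
exists (fun x => tr (psi x (g x))); split=> //.
by apply: embed_mono => x x'; rewrite trS psi_blue.
Qed.

End Existence.

(* ex_minn returns the least witness. *)
Definition poset_ramsey d d' (P : finPOrderType d) (Q : finPOrderType d') : nat :=
  ex_minn (ramsey_arrow_exists P Q).

End PosetRamsey.

Definition log2 (R : realType) (x : R) : R := (ln x / ln 2)%R.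

(* Main.v *)
Require Import Defs.
From mathcomp Require Import all_boot all_order all_algebra.
From mathcomp Require Import boolp reals exp.
From mathcomp Require Import zify ring lra.
Import Order.TTheory GRing.Theory Num.Theory.

Set Implicit Arguments.
Unset Strict Implicit.
Unset Printing Implicit Defensive.

(* Build a blue copy of Q_m as S |-> S :|: F S, where S ranges over the subsets of
   an m-set and F S is the union of increments w S' over S' \subset S.  Below level K
   look for increments of at most tau elements: F S then has at most 2 ^ #|S| * tau
   elements, so levels 0..K all fit into one region of size n + (2 ^ K - 1) * tau,
   instead of taking a fresh n-element block for each level.  If the search fails at
   S, all sets within distance tau above some small V are red, that is, tau + 1 layers
   of a red Q_n are free, and each of the other n - tau layers costs one m-element
   block.  The top element of Q_m is treated dually, which saves one more block.
   With K = floor ((1 - eps) log m) and tau = floor (n (1 - eps) log m / m), both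
   outcomes fit into the claimed dimension. *)

(** * Lattice copies built level by level *)

(** Choice along strict inclusion, by induction on the level: [fin_all_exists] picks the values on
    level [k], and changing [w] only there leaves the unions over proper subsets intact for sets up
    to that level. *)
Lemma greedy_choice (T U : finType) (P : {set T} -> {set U} -> {set U} -> Prop) :
  (forall (S : {set T}) (w : {set T} -> {set U}),
     (forall S' : {set T}, S' \proper S ->
        P S' (\bigcup_(S'' : {set T} | S'' \proper S') w S'') (w S')) ->
     exists W, P S (\bigcup_(S' : {set T} | S' \proper S) w S') W) ->
  exists w : {set T} -> {set U},
    forall S, P S (\bigcup_(S' : {set T} | S' \proper S) w S') (w S).
Proof.
move=> H.
suff [w Hw] : exists w : {set T} -> {set U}, forall S : {set T}, #|S| < #|T|.+1 ->
    P S (\bigcup_(S' : {set T} | S' \proper S) w S') (w S).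
  by exists w => S; apply: Hw; rewrite ltnS max_card.
elim: _.+1 => [|k [w Hw]]; first by exists (fun _ => set0).
have Hk (S : {set T}) : exists W, #|S| = k ->
    P S (\bigcup_(S' : {set T} | S' \proper S) w S') W.
  have [Sk|/eqP Sk] := eqVneq #|S| k; last by exists set0.
  have [|W HW] := H S w; last by exists W.
  by move=> S' /proper_card; rewrite Sk; apply: Hw.
have [v Hv] := fin_all_exists Hk.
exists (fun S : {set T} => if #|S| == k then v S else w S) => S.
rewrite ltnS => Sk.
have -> : \bigcup_(S' : {set T} | S' \proper S) (if #|S'| == k then v S' else w S')
    = \bigcup_(S' : {set T} | S' \proper S) w S'.
  apply: eq_bigr => S' /proper_card S'S.
  by rewrite ltn_eqF // (leq_trans S'S).
case: eqP => [/Hv //|/eqP SkN]; apply: Hw.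
by rewrite ltn_neqAle SkN.
Qed.

(** The trace on [Y] recovers [S] from [F S], so a monotone [F] reflects the order as well;
    [enum_val] identifies ['I_#|Y|] with [Y]. *)
Lemma lattice_copy (N : nat) (c : {set 'I_N} -> bool) (b : bool) (Y : {set 'I_N})
    (F : {set 'I_N} -> {set 'I_N}) :
  (forall S : {set 'I_N}, S \subset Y -> F S :&: Y = S) ->
  (forall S S' : {set 'I_N}, S \subset S' -> S' \subset Y -> F S \subset F S') ->
  (forall S : {set 'I_N}, S \subset Y -> c (F S) = b) ->
  has_mono_copy (boolean_lattice #|Y|) c b.
Proof.
move=> FY Fm Fc; pose e (S : {set 'I_#|Y|}) := [set enum_val i | i in S].
have eY S : e S \subset Y.
  by apply/subsetP => _ /imsetP[i _ ->]; apply: enum_valP.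
have eS S S' : (F (e S) \subset F (e S')) = (S \subset S').
  apply/idP/idP => [|SS']; last by apply: Fm => //; apply: imsetS.
  move=> /(setSI Y); rewrite !FY // => /subsetP H; apply/subsetP => i iS.
  have /imsetP[j jS' /enum_val_inj ->//] : enum_val i \in e S'.
  by apply: H; apply: imset_f.
exists (fun S => F (e S)); split=> [|S]; last exact: Fc.
split=> [S S' FF|S S'].
  by apply/eqP; rewrite eqEsubset -!eS FF subxx.
by rewrite /Order.le /= eS.
Qed.

Lemma card_bigcup_proper (T U : finType) (S : {set T}) (w : {set T} -> {set U}) (tau : nat) :
  (forall S' : {set T}, S' \proper S -> #|w S'| <= tau) ->
  #|\bigcup_(S' : {set T} | S' \proper S) w S'| <= (2 ^ #|S| - 1) * tau.
Proof.
move=> H.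
have -> : (2 ^ #|S| - 1) * tau = \sum_(S' : {set T} | S' \proper S) tau.
  rewrite sum_nat_const; congr (_ * _).
  rewrite -card_powerset (cardsD1 S) powersetE subxx add1n subn1.
  by apply: eq_card => S'; rewrite !inE -properEneq.
elim/big_ind2: _ => [|A a B b' Aa Bb|S' /H //]; first by rewrite cards0.
by apply: leq_trans (leq_add Aa Bb); rewrite cardsU leq_subr.
Qed.

(** [D j] is the space open to increments from levels below [j], and [U] stands for the union of the
    increments at proper subsets of [S]. Since increments avoid [Y], the trace on [Y] stays [S]. *)
Lemma layered_copy (N : nat) (c : {set 'I_N} -> bool) (b : bool) (Y : {set 'I_N})
    (D : nat -> {set 'I_N}) (K tau : nat) :
  {homo D : i j / i <= j >-> i \subset j} ->
  (forall j, [disjoint D j & Y]) ->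
  (forall S U : {set 'I_N}, S \subset Y -> U \subset D #|S| ->
     (#|S| <= K -> #|U| <= (2 ^ #|S| - 1) * tau) ->
     exists W : {set 'I_N}, [/\ W \subset D #|S|.+1, #|S| < K -> #|W| <= tau
                              & c (S :|: U :|: W) = b]) ->
  has_mono_copy (boolean_lattice #|Y|) c b.
Proof.
move=> Dm DY H.
pose P (S U W : {set 'I_N}) := S \subset Y ->
  [/\ W \subset D #|S|.+1, #|S| < K -> #|W| <= tau & c (S :|: U :|: W) = b].
have [|w Hw] := @greedy_choice 'I_N 'I_N P.
  move=> S w Hw; have [SY|SY] := boolP (S \subset Y); last first.
    by exists set0 => /idP; rewrite (negbTE SY).
  have wP (S' : {set 'I_N}) : S' \proper S ->
      w S' \subset D #|S'|.+1 /\ (#|S'| < K -> #|w S'| <= tau).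
    by move=> S'S; have [|//] := Hw S' S'S; apply: subset_trans (proper_sub S'S) SY.
  have [||W HW] := H S (\bigcup_(S' : {set 'I_N} | S' \proper S) w S') SY; last by exists W.
    apply/bigcupsP => S' S'S; have [wD _] := wP S' S'S.
    by apply: subset_trans wD (Dm _ _ _); apply: proper_card.
  (* Proper subsets of [S] lie below level [K], so each of their increments has at most [tau]
     elements. *)
  move=> SK; apply: card_bigcup_proper => S' S'S; apply: (wP S' S'S).2.
  by apply: leq_trans SK; apply: proper_card.
pose F (S : {set 'I_N}) := S :|: \bigcup_(S' : {set 'I_N} | S' \subset S) w S'.
have FE S : F S = S :|: (\bigcup_(S' : {set 'I_N} | S' \proper S) w S') :|: w S.
  rewrite /F (bigD1 S) //= -setUA [w S :|: _]setUC; congr (_ :|: (_ :|: _)).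
  by apply: eq_bigl => S'; rewrite properEneq andbC.
apply: (@lattice_copy N c b Y F) => [S SY|S S' SS' S'Y|S SY].
- rewrite setIUl (setIidPl SY); apply/setUidPl; apply: (subset_trans _ (sub0set _)).
  apply/subsetP => x /setIP[/bigcupP[S' S'S xw] xY].
  have [wD _ _] := Hw S' (subset_trans S'S SY).
  by have /pred0P/(_ x) := DY #|S'|.+1; rewrite /= (subsetP wD) // xY.
- apply: setUSS => //; apply/bigcupsP => S'' S''S.
  by apply: bigcup_sup; apply: subset_trans S''S SS'.
- by rewrite FE; have [] := Hw S SY.
Qed.

(** * Blocks cut from a region of free elements *)

(** Prefixes of one enumeration form a chain of prescribed sizes; a too large [k] gives all of
    [R]. *)
Definition first_elts (T : finType) (R : {set T}) (k : nat) : {set T} :=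
  [set x in take k (enum R)].

Lemma first_elts_sub (T : finType) (R : {set T}) (k : nat) : first_elts R k \subset R.
Proof. by apply/subsetP => x; rewrite inE => /mem_take; rewrite mem_enum. Qed.

Lemma first_elts_mono (T : finType) (R : {set T}) :
  {homo first_elts R : i j / i <= j >-> i \subset j}.
Proof.
move=> i j ij; apply/subsetP => x; rewrite !inE => xi.
by apply: (@mem_take i); rewrite take_takel.
Qed.

Lemma card_first_elts (T : finType) (R : {set T}) (k : nat) :
  #|first_elts R k| = minn k #|R|.
Proof.
rewrite /first_elts cardsE (card_uniqP _) ?take_uniq ?enum_uniq //.
by rewrite size_take_min -cardE.
Qed.

Lemma first_elts_all (T : finType) (R : {set T}) (k : nat) :
  #|R| <= k -> first_elts R k = R.
Proof.
move=> Rk; apply/eqP; rewrite eqEcard first_elts_sub card_first_elts.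
by rewrite (minn_idPr Rk) leqnn.
Qed.

(** If every set in between had the wrong colour, [d] elements of [R] between positions [i] and [j]
    would span an excluded lattice above the base [A]. *)
Lemma blob (N d : nat) (c : {set 'I_N} -> bool) (b : bool) (S V R : {set 'I_N}) (i j : nat) :
  ~ has_mono_copy (boolean_lattice d) c (~~ b) ->
  [disjoint S & R] -> [disjoint V & R] -> i + d <= j -> j <= #|R| ->
  exists W : {set 'I_N}, [/\ V :|: first_elts R i \subset W,
    W \subset V :|: first_elts R j & c (S :|: W) = b].
Proof.
move=> nocopy SR VR idj jR; apply: contrapT => noW; apply: nocopy.
pose X := first_elts (first_elts R j :\: first_elts R i) d.
have XR : X \subset first_elts R j :\: first_elts R i by apply: first_elts_sub.
have ij : i <= j by apply: leq_trans idj; apply: leq_addr.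
have cX : #|X| = d.
  rewrite card_first_elts (minn_idPl _) // cardsDS; last exact: first_elts_mono.
  by rewrite !card_first_elts (minn_idPl jR) (minn_idPl (leq_trans ij jR)) leq_subRL.
pose A := S :|: (V :|: first_elts R i).
have AX : [disjoint A & X].
  rewrite disjoint_sym disjoints_subset; apply: subset_trans XR _.
  apply/subsetP => x; rewrite in_setD => /andP[xi /(subsetP (first_elts_sub _ _)) xR].
  rewrite 2!inE negb_or; apply/andP; split; last rewrite inE negb_or xi andbT.
    by apply: contraL xR => xS; rewrite (disjointFr SR).
  by apply: contraL xR => xV; rewrite (disjointFr VR).
rewrite -[in has_mono_copy _]cX.
apply: (@lattice_copy N c (~~ b) X (fun T => A :|: T)) => [T TX|T T' TT' _|T TX].
- rewrite setIUl (setIidPl TX) (_ : A :&: X = set0) ?set0U //.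
  by apply/eqP; rewrite setI_eq0.
- exact: setUS.
- have [//|cb] := eqVneq (c (A :|: T)) (~~ b); case: noW.
  exists (V :|: first_elts R i :|: T); split.
  + exact: subsetUl.
  + rewrite -setUA setUS // subUset first_elts_mono //=.
    by apply: subset_trans TX (subset_trans XR (subsetDl _ _)).
  + by move: cb; rewrite /A -!setUA; case: (c _); case: (b).
Qed.

Lemma layered_region_copy (N K tau : nat) (c : {set 'I_N} -> bool) (b : bool)
    (Y V R : {set 'I_N}) (k : nat -> nat) :
  [disjoint Y & V] -> [disjoint Y & R] ->
  {homo k : i j / i <= j} ->
  (forall S U : {set 'I_N}, S \subset Y -> U \subset V :|: first_elts R (k #|S|) ->
     (#|S| <= K -> #|U| <= (2 ^ #|S| - 1) * tau) ->
     exists W : {set 'I_N}, [/\ W \subset V :|: first_elts R (k #|S|.+1),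
       #|S| < K -> #|W| <= tau & c (S :|: U :|: W) = b]) ->
  has_mono_copy (boolean_lattice #|Y|) c b.
Proof.
move=> YV YR km H.
apply: (@layered_copy N c b Y (fun j => V :|: first_elts R (k j)) K tau) => //.
  by move=> i j ij; apply/setUS/first_elts_mono/km.
move=> j; rewrite disjoint_sym disjoints_subset; apply/subsetP => x xY.
rewrite 2!inE negb_or (disjointFr YV xY) /=.
by apply: contraFN (disjointFr YR xY) => /(subsetP (first_elts_sub _ _)).
Qed.

(** The set given by [blob] swallows the earlier increments [U], so one block of [d] elements serves
    all sets of a level at once. *)
Lemma blob_layer (N d K tau : nat) (c : {set 'I_N} -> bool) (b : bool)
    (S U V R : {set 'I_N}) (i j : nat) :
  ~ has_mono_copy (boolean_lattice d) c (~~ b) ->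
  [disjoint S & R] -> [disjoint V & R] -> i + d <= j -> j <= #|R| ->
  U \subset V :|: first_elts R i -> K <= #|S| ->
  exists W : {set 'I_N}, [/\ W \subset V :|: first_elts R j,
       #|S| < K -> #|W| <= tau & c (S :|: U :|: W) = b].
Proof.
move=> nocopy SR VR ij jR UV KS.
have [W [VW WV cW]] := blob nocopy SR VR ij jR.
exists W; split=> //; first by rewrite ltnNge KS.
by rewrite -setUA (setUidPr (subset_trans UV VW)).
Qed.

(** * Lattice copies when some layers come for free *)

(** On levels 0 to [tau] the sets [V :|: S] serve directly; each of the [n - tau] levels above takes
    a block of [m] elements outside [X :|: V]. *)
Lemma copy_above_lower_layers (N n m tau : nat) (c : {set 'I_N} -> bool) (b : bool)
    (V X : {set 'I_N}) :
  ~ has_mono_copy (boolean_lattice m) c (~~ b) ->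
  [disjoint X & V] -> #|X| = n -> n + #|V| + (n - tau) * m <= N ->
  (forall W : {set 'I_N}, W \subset X -> #|W| <= tau -> c (V :|: W) = b) ->
  has_mono_copy (boolean_lattice n) c b.
Proof.
move=> nocopy XV cX NVX low; rewrite -cX.
pose R := ~: (X :|: V).
have cR : (n - tau) * m <= #|R|.
  rewrite cardsCs setCK card_ord; have : #|X :|: V| <= n + #|V| by rewrite cardsU cX leq_subr.
  by lia.
have XR : [disjoint X & R] by rewrite disjoints_subset setCK subsetUl.
have VR : [disjoint V & R] by rewrite disjoints_subset setCK subsetUr.
(* Truncated subtraction keeps the segment of [R] empty for all levels up to [tau]; [K = 0] puts no
   size bound on increments. *)
apply: (@layered_region_copy N 0 0 c b X V R (fun j => (j - tau.+1) * m)) => //.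
  by move=> i j ij; rewrite leq_mul2r leq_sub2r ?orbT.
move=> S U SX US _; have := subset_leq_card SX; rewrite cX => Sn.
have [St|tS] := leqP #|S| tau.
  have E j : j <= tau.+1 -> V :|: first_elts R ((j - tau.+1) * m) = V.
    move=> jt; rewrite (eqP (_ : j - tau.+1 == 0)) // mul0n.
    by apply/setUidPl/subsetP => x; rewrite inE take0.
  exists V; split=> //; first by rewrite E.
  have UV : U \subset V by move: US; rewrite E ?(leqW St).
  by rewrite -setUA (setUidPr UV) setUC low.
apply: (@blob_layer N m 0 0 c b S U V R ((#|S| - tau.+1) * m) ((#|S|.+1 - tau.+1) * m)) => //.
- by apply: disjointWl XR.
- by rewrite -mulSnr -subSn.
- by apply: leq_trans cR; rewrite subSS leq_mul2r leq_sub2r ?orbT.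
Qed.

(** Levels below [n - tau] take blocks of [m] elements. From level [n - tau] on the increment is all
    of [R], and [S :|: R] is the complement of [X :\: S], which has at most [tau] elements. *)
Lemma copy_below_upper_layers (N n m tau : nat) (c : {set 'I_N} -> bool) (b : bool) :
  ~ has_mono_copy (boolean_lattice m) c (~~ b) ->
  n + (n - tau) * m <= N ->
  (forall W : {set 'I_N}, #|W| <= tau -> c (~: W) = b) ->
  has_mono_copy (boolean_lattice n) c b.
Proof.
move=> nocopy Nnm up.
pose X := first_elts [set: 'I_N] n.
have cX : #|X| = n by rewrite card_first_elts cardsT card_ord; lia.
pose R := ~: X; have cR : #|R| = N - n by rewrite cardsCs setCK card_ord cX.
have XR : [disjoint X & R] by rewrite disjoints_subset setCK.
have D0 (A : {set 'I_N}) : [disjoint A & (set0 : {set 'I_N})].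
  by rewrite disjoint_sym disjoints_subset sub0set.
rewrite -cX.
apply: (@layered_region_copy N 0 0 c b X set0 R
  (fun j => if j <= n - tau then j * m else N)) => //.
  move=> i j ij; case: ifP => it; case: ifP => jt //; last by lia.
    by rewrite leq_mul2r ij orbT.
  by have : i * m <= (n - tau) * m; [rewrite leq_mul2r it orbT | lia].
move=> S U SX /= US _; have := subset_leq_card SX; rewrite cX => Sn.
have [St|tS] := ltnP #|S| (n - tau).
  rewrite (ltnW St) in US.
  apply: (@blob_layer N m 0 0 c b S U set0 R (#|S| * m) (#|S|.+1 * m)) => //.
  - exact: disjointWl XR.
  - by rewrite disjoint_sym.
  - by rewrite -mulSnr.
  - by rewrite cR; have : #|S|.+1 * m <= (n - tau) * m; [rewrite leq_mul2r St orbT | lia].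
have UR : U \subset R.
  by apply: subset_trans US _; rewrite set0U first_elts_sub.
exists R; split=> //; first by rewrite set0U first_elts_all // cR leq_subr.
rewrite -setUA (setUidPr UR) -[_ :|: _]setCK up // setCU setCK setIC.
by rewrite -setDE cardsDS // cX; lia.
Qed.

(** * The dimension bound with parameters [K] and [tau] *)

(** The first inequality on [N] is the room for the blue copy: [m] for [Y], at most [tau] for [Z], n
    + (2^K - 1) tau shared by levels 0 to [K], and [n] for each level from [K + 1] to [m - 1]. The
    second is the room for a red copy above [S :|: U]. *)
Lemma ramsey_arrow_lattices (N n m K tau : nat) :
  K < m -> tau <= n ->
  m + (m - K) * n + 2 ^ K * tau <= N ->
  n + (K.-1 + (2 ^ K.-1 - 1) * tau) + (n - tau) * m <= N ->
  ramsey_arrow (boolean_lattice m) (boolean_lattice n) N.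
Proof.
move=> Km taun N1 N2 c; apply: contrapT => /not_orP[noblue nored].
(* Without such a [Z] all sets missing at most [tau] elements would be red. *)
have [Z [cZ blueZ]] : exists Z : {set 'I_N}, #|Z| <= tau /\ c (~: Z) = true.
  apply: contrapT => noZ; apply: nored.
  apply: (@copy_below_upper_layers N n m tau c false) => // [|W Wtau].
    by apply: leq_trans N2; rewrite leq_add2r leq_addr.
  by apply/negP => cW; case: noZ; exists W.
pose Y := first_elts (~: Z) m; pose R := ~: (Y :|: Z).
have cZC : #|~: Z| = N - #|Z| by rewrite cardsCs setCK card_ord.
have mK : n <= (m - K) * n by rewrite leq_pmull // subn_gt0.
have e2 : 0 < 2 ^ K by rewrite expn_gt0.
have tau2 : tau + (2 ^ K - 1) * tau = 2 ^ K * tau by rewrite -mulSn -add1n subnKC.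
have cY : #|Y| = m by rewrite card_first_elts cZC; lia.
have YZ : Y \subset ~: Z by apply: first_elts_sub.
pose z := n + (2 ^ K - 1) * tau.
have cR : z + (m - K.+1) * n <= #|R|.
  have : (m - K.+1) * n + n = (m - K) * n by rewrite -mulSnr -subSn.
  rewrite /z cardsCs setCK card_ord.
  have : #|Y :|: Z| <= m + #|Z| by rewrite cardsU cY leq_subr.
  by lia.
have YR : [disjoint Y & R] by rewrite disjoints_subset setCK subsetUl.
have s0 (A : {set 'I_N}) : [disjoint (set0 : {set 'I_N}) & A].
  by rewrite disjoints_subset sub0set.
apply: (noblue); rewrite -cY.
(* Level [l] may use the first [k l.+1] elements: levels up to [K] share [z] of them, later ones add
   [n] each, and the value [N] gives the top level all of [R]. *)
pose k j := if j <= m then z + (j - K.+1) * n else N.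
have kle j : j <= m -> k j <= #|R|.
  move=> jm; rewrite /k jm; apply: leq_trans cR.
  by rewrite leq_add2l leq_mul2r leq_sub2r ?orbT.
have cRN : #|R| <= N by rewrite -[leqRHS]card_ord max_card.
apply: (@layered_region_copy N K tau c true Y set0 R k) => //.
- by rewrite disjoint_sym.
- move=> i j ij; rewrite {2}/k; case: ifP => jm.
    by rewrite /k (leq_trans ij jm) leq_add2l leq_mul2r leq_sub2r ?orbT.
  have [im|mi] := leqP i m; first by apply: leq_trans (kle _ im) cRN.
  by rewrite /k (ltn_geF mi).
move=> S U SY US Ucard; rewrite !set0U in US *.
have := subset_leq_card SY; rewrite cY leq_eqVlt => /predU1P[Sm|Sm].
  (* The top element S = Y is sent to the blue set ~: Z. *)
  exists R; split; first by rewrite /k Sm ltnn first_elts_all.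
    by rewrite Sm ltnNge (ltnW Km).
  have -> : S = Y by apply/eqP; rewrite eqEcard SY cY Sm leqnn.
  rewrite -setUA (setUidPr (subset_trans US (first_elts_sub _ _))) -blueZ.
  by rewrite /R setCU setUIr setUCr setTI (setUidPr YZ).
have SR : [disjoint S & R] by apply: disjointWl YR.
have [KS|SK] := ltnP K #|S|.
  rewrite -[first_elts R _]set0U.
  apply: (@blob_layer N n K tau c true S U set0 R (k #|S|) (k #|S|.+1)) => //.
  - by rewrite /k Sm (ltnW Sm) -addnA -mulSnr subSS subnSK.
  - exact: kle.
  - by rewrite set0U.
  - exact: ltnW.
pose Z0 := first_elts R z.
have kS : k #|S|.+1 = z by rewrite /k Sm (eqP (_ : #|S|.+1 - K.+1 == 0)) // addn0.
have kS' : k #|S| = z.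
  by rewrite /k (ltnW Sm) (eqP (_ : #|S| - K.+1 == 0)) ?addn0 // subn_eq0 leqW.
rewrite kS; rewrite kS' in US.
have UZ : U \subset Z0 by [].
have {}Ucard := Ucard SK.
have cZ0 : #|Z0| = z.
  by rewrite card_first_elts (minn_idPl _) // -kS kle.
have Z0R : Z0 \subset R by apply: first_elts_sub.
(* [U] has at most (2^K - 1) tau elements, so [z] leaves [n] fresh ones. *)
have cZU : n <= #|Z0 :\: U|.
  rewrite cardsDS // cZ0 -addnBA ?leq_addr //; apply: leq_trans Ucard _.
  by rewrite leq_mul2r leq_sub2r ?orbT // leq_exp2l.
have SZ : [disjoint S & Z0 :\: U].
  by apply: disjointWr SR; apply: subset_trans (subsetDl _ _) Z0R.
pose X := first_elts (Z0 :\: U) n.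
have cX : #|X| = n by rewrite card_first_elts (minn_idPl _).
have XZ : X \subset Z0 :\: U by apply: first_elts_sub.
(* No blue set within reach of S :|: U makes everything near it red. *)
apply: contrapT => noW; apply: nored.
have XSU : [disjoint X & S :|: U].
  rewrite disjoints_subset; apply: subset_trans XZ _.
  rewrite setCU subsetI -disjoints_subset disjoint_sym SZ /=.
  by apply/subsetP => x; rewrite !inE => /andP[].
have noblueW (W : {set 'I_N}) : W \subset X -> (#|S| < K -> #|W| <= tau) ->
    c (S :|: U :|: W) = false.
  move=> WX Wtau; apply/negP => cW; case: noW; exists W; split=> //.
  by apply: subset_trans WX (subset_trans XZ (subsetDl _ _)).
have [SltK|KleS] := ltnP #|S| K; last first.
  (* At level [K] the size of [W] is free, so the whole lattice over [X] is red. *)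
  rewrite -cX.
  apply: (@lattice_copy N c false X (fun T => S :|: U :|: T)) => [T TX|T T' TT' _|T TX].
  - rewrite setIUl (setIidPl TX) (_ : _ :&: X = set0) ?set0U //.
    by apply/eqP; rewrite setI_eq0 disjoint_sym.
  - exact: setUS.
  - by apply: noblueW => //; rewrite ltnNge KleS.
apply: (@copy_above_lower_layers N n m tau c false (S :|: U) X) => //; last first.
  by move=> W WX Wtau; apply: noblueW.
(* Only levels below [K] reach this point, whence [K.-1] in the second bound. *)
apply: leq_trans N2; rewrite leq_add2r leq_add2l.
apply: leq_trans (_ : #|S| + #|U| <= _); first by rewrite cardsU leq_subr.
have SK1 : #|S| <= K.-1 by rewrite -ltnS (ltn_predK SltK).
apply: leq_add => //; apply: leq_trans Ucard _.
by rewrite leq_mul2r leq_sub2r ?orbT // leq_exp2l.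
Qed.

Local Open Scope ring_scope.

(** * Passage to the Ramsey number and real estimates *)

Lemma poset_ramsey_le (m n N : nat) :
  ramsey_arrow (boolean_lattice m) (boolean_lattice n) N ->
  (poset_ramsey (boolean_lattice m) (boolean_lattice n) <= N)%N.
Proof.
by move=> H; rewrite /poset_ramsey; case: ex_minnP => N' _; apply; apply/asboolP.
Qed.

Lemma poset_ramsey_lattices_le (m n K tau : nat) :
  (K < m)%N -> (tau <= n)%N ->
  (poset_ramsey (boolean_lattice m) (boolean_lattice n) <=
     maxn (m + (m - K) * n + 2 ^ K * tau)
          (n + (K.-1 + (2 ^ K.-1 - 1) * tau) + (n - tau) * m))%N.
Proof.
move=> Km taun; apply: poset_ramsey_le.
by apply: (ramsey_arrow_lattices Km taun); rewrite ?leq_maxl ?leq_maxr.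
Qed.

(** For a = n, b = m, k = [K], x = [kappa]: in the slack n + m, [m] pays for [Y] and [n] for
    rounding [kappa] down. *)
Lemma lower_levels_slack (F : realFieldType) (a b k x : F) :
  a * x <= a * (k + 1) -> b + (b - k) * a <= a * (b - x) + (a + b).
Proof. by move=> H; lra. Qed.

(** Same slack with k = [tau]: now [n] pays for [X] and [m] for rounding n kappa / m down. *)
Lemma free_layers_slack (F : realFieldType) (a b k x y z : F) :
  a * x <= (k + 1) * b -> y <= z ->
  a + y + (a - k) * b <= a * (b - x) + (a + b) + z.
Proof. by move=> H1 H2; lra. Qed.

(** Equivalent to exp(-1/2) >= 1/2, an instance of exp(x) >= 1 + x. *)
Lemma half_le_ln2 (R : realType) : 2^-1 <= ln 2 :> R.
Proof.
rewrite -(expRK 2^-1) ler_ln ?posrE ?expR_gt0 //.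
rewrite -[leLHS]invrK -expRN -[leRHS]invrK lef_pV2 ?posrE ?expR_gt0 ?invr_gt0 //.
by apply: le_trans (expR_ge1Dx _); lra.
Qed.

Lemma ln2_gt0 (R : realType) : 0 < ln 2 :> R.
Proof. by apply: lt_le_trans (half_le_ln2 R); rewrite invr_gt0. Qed.

Lemma powR2_log2 (R : realType) (x : R) : 0 < x -> 2 `^ (log2 x) = x.
Proof.
move=> x0; rewrite /powR pnatr_eq0 /= /log2 divfK ?lnK //.
by rewrite gt_eqF ?ln2_gt0.
Qed.

Lemma powR2_ge1Dhalf (R : realType) (x : R) : 0 <= x -> 1 + x / 2 <= 2 `^ x.
Proof.
move=> x0; rewrite /powR pnatr_eq0 /=.
apply: le_trans (expR_ge1Dx _); rewrite lerD2l.
by apply: ler_wpM2l => //; apply: half_le_ln2.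
Qed.

(** * The bound for general [eps] *)

(** Both terms of the maximum are at most n (m - kappa) + (n + m) + n kappa p with p = m^(-eps). The
    hypothesis times n kappa bounds the part after n (m - kappa) by n kappa eps. *)
Lemma poset_ramsey_lattices_eps (R : realType) (n m : nat) (eps : R) : (0 < m)%N -> (m <= n)%N ->
  0 < eps -> eps < 1 ->
  (n%:R + m%:R) / n%:R * (1 / ((1 - eps) * log2 m%:R)) + m%:R `^ (- eps) <= eps ->
  (poset_ramsey (boolean_lattice m) (boolean_lattice n))%:R
    <= n%:R * (m%:R - (1 - eps) ^+ 2 * log2 m%:R) :> R.
Proof.
move=> m0 mn e0 e1 Heps.
have mR0 : 0 < m%:R :> R by rewrite ltr0n.
have nR0 : 0 < n%:R :> R by rewrite ltr0n (leq_trans m0).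
have mnR : m%:R <= n%:R :> R by rewrite ler_nat.
(* For m = 1 the junk value 1 / 0 = 0 leaves 1 <= eps in the hypothesis. *)
have m1 : (1 < m)%N.
  rewrite ltn_neqAle m0 andbT; apply/eqP => m1; move: Heps.
  by rewrite -m1 /log2 ln1 mul0r mulr0 invr0 !mulr0 powR1 add0r; lra.
set L : R := log2 m%:R in Heps *.
have L0 : 0 < L by rewrite divr_gt0 ?ln2_gt0 // ln_gt0 // ltr1n.
have e1' : 0 < 1 - eps by lra.
pose kappa := (1 - eps) * L.
have k0 : 0 < kappa by rewrite mulr_gt0.
have pk : 2 `^ kappa = m%:R * m%:R `^ (- eps).
  rewrite /kappa mulrC powRrM powR2_log2 //.
  by rewrite powRD ?(gt_eqF mR0) ?implybT // powRr1 // ltW.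
pose p : R := m%:R `^ (- eps).
have p0 : 0 < p by rewrite powR_gt0.
have p1 : p < 1.
  apply: le_lt_trans e1; apply: le_trans Heps; rewrite lerDr.
  by apply: mulr_ge0; [rewrite divr_ge0 ?addr_ge0 ?ler0n | apply/ltW/divr_gt0].
pose K := Num.truncn kappa.
have [Kk kK] : K%:R <= kappa /\ kappa < K.+1%:R.
  by have /andP[] := truncn_itv (ltW k0).
have K2k : 2 ^+ K <= 2 `^ kappa by rewrite -powR_mulrn // ler_powR // ler1n.
have Km : (K < m)%N.
  apply: leq_ltn_trans (ltnW (ltn_expl K (ltnSn 1))) _.
  by rewrite -(ltr_nat R) natrX (le_lt_trans K2k) // pk gtr_pMr.
have nkm0 : 0 < n%:R * kappa / m%:R by rewrite divr_gt0 // mulr_gt0.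
pose tau := Num.truncn (n%:R * kappa / m%:R).
have /andP[tau1 tau2'] := truncn_itv (ltW nkm0); rewrite -/tau in tau1 tau2'.
have tau2 : n%:R * kappa <= (tau%:R + 1) * m%:R.
  by rewrite natr1 -ler_pdivrMr // ltW.
have taun : (tau <= n)%N.
  rewrite -(ler_nat R); apply: le_trans tau1 _; rewrite ler_pdivrMr //.
  by rewrite ler_pM2l // (le_trans (ltW kK)) // ler_nat.
have key : (n%:R + m%:R) + n%:R * kappa * p <= n%:R * kappa * eps.
  have nk0 : 0 < n%:R * kappa by rewrite mulr_gt0.
  have := ler_wpM2l (ltW nk0) Heps; rewrite -/kappa -/p mulrDr; congr (_ + _ <= _).
  by field; rewrite !gt_eqF.
have target : n%:R * (m%:R - (1 - eps) ^+ 2 * L)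
    = n%:R * (m%:R - kappa) + n%:R * kappa * eps.
  by rewrite /kappa; ring.
have pow_tau : 2 ^+ K * tau%:R <= n%:R * kappa * p.
  apply: le_trans (ler_pM _ _ K2k tau1) _; rewrite ?exprn_ge0 // pk.
  by rewrite -/p le_eqVlt; apply/orP; left; apply/eqP; field; rewrite gt_eqF.
apply: (@le_trans _ _ (n%:R * (m%:R - kappa) + (n%:R + m%:R) + n%:R * kappa * p)); last first.
  by rewrite target -addrA lerD2l.
apply: (@le_trans _ _ (maxn (m + (m - K) * n + 2 ^ K * tau)
          (n + (K.-1 + (2 ^ K.-1 - 1) * tau) + (n - tau) * m))%:R).
  by rewrite ler_nat; apply: poset_ramsey_lattices_le.
have [_|_] := leqP; last first.
  rewrite !natrD !natrM natrX natrB ?(ltnW Km) //.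
  have Kn : n%:R * kappa <= n%:R * (K%:R + 1) by rewrite ler_pM2l // natr1 ltW.
  apply: lerD pow_tau.
  exact: lower_levels_slack.
(* For [K] positive, [tau] is positive because n kappa / m >= kappa >= 1; then half of 2^K tau
   absorbs [K.-1]. *)
have low : (K.-1 + (2 ^ K.-1 - 1) * tau <= 2 ^ K * tau)%N.
  case EK : K => [|k] /=; first by rewrite subnn mul0n.
  have tau_gt0 : (0 < tau)%N.
    rewrite truncn_gt0 ler_pdivlMr // mul1r (le_trans mnR) // ler_peMr ?ler0n //.
    by apply: le_trans Kk; rewrite EK ler1n.
  rewrite expnS mul2n -addnn mulnDl leq_add //; last by rewrite leq_mul2r leq_subr orbT.
  by apply: leq_trans (ltnW (ltn_expl k (ltnSn 1))) _; rewrite leq_pmulr.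
have {}low : (K.-1 + (2 ^ K.-1 - 1) * tau)%:R <= n%:R * kappa * p.
  by apply: le_trans pow_tau; rewrite -natrX -natrM ler_nat.
move: (K.-1 + _)%N low => B low; rewrite !natrD natrM natrB //.
exact: free_layers_slack.
Qed.

(** * The choice eps = 1 / sqrt(log m) *)

(** Split off 2^5 = 32 and bound 2^(x - 5) below linearly. *)
Lemma twice_le_powR2 (R : realType) (x : R) : 5 <= x -> 2 * x <= 2 `^ x.
Proof.
move=> x5; rewrite -(subrK 5 x) powRD ?pnatr_eq0 ?implybT // addrC.
have -> : 2 `^ 5 = 32 :> R by rewrite powR_mulrn //; ring.
have := powR2_ge1Dhalf (_ : 0 <= x - 5); rewrite subr_ge0 => /(_ x5).
move: (2 `^ _) => y; lra.
Qed.

Lemma sqrt_log2_ge5 (R : realType) (m : nat) : (2 ^ 25 <= m)%N -> 5 <= Num.sqrt (log2 m%:R) :> R.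
Proof.
move=> m25; have m0 : (0 < m)%N by apply: leq_trans m25; rewrite expn_gt0.
have -> : 5 = Num.sqrt (5 ^+ 2) :> R by rewrite sqrtr_sqr ger0_norm.
apply: ler_wsqrtr; rewrite (_ : 5 ^+ 2 = 25%:R); last by ring.
rewrite /log2 ler_pdivlMr ?ln2_gt0 // mulr_natl -lnXn //.
by rewrite ler_ln ?posrE ?exprn_gt0 ?ltr0n // -natrX ler_nat.
Qed.

(** With s = sqrt(log m), the terms are at most 2 / (s (s - 1)) and 2^(-s) <= 1 / (2 s). The slack
    left is (s - 5) / (2 s (s - 1)), so s >= 5, that is m >= 2^25, suffices. *)
Lemma sqrt_eps_condition (R : realType) (n m : nat) : (2 ^ 25 <= m)%N -> (m <= n)%N ->
  let eps : R := (Num.sqrt (log2 m%:R))^-1 in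
  (n%:R + m%:R) / n%:R * (1 / ((1 - eps) * log2 m%:R)) + m%:R `^ (- eps) <= eps.
Proof.
move=> m25 mn /=; set L := log2 _; set s := Num.sqrt L.
have m0 : (0 < m)%N by apply: leq_trans m25; rewrite expn_gt0.
have mR0 : 0 < m%:R :> R by rewrite ltr0n.
have nR0 : 0 < n%:R :> R by rewrite ltr0n (leq_trans m0).
have s5 : 5 <= s by apply: sqrt_log2_ge5.
have s0 : 0 < s by apply: lt_le_trans s5.
have sL : L = s * s by rewrite -expr2 sqr_sqrtr // ltW // -sqrtr_gt0.
have -> : m%:R `^ (- s^-1) = (2 `^ s)^-1.
  rewrite -(powR2_log2 mR0) -/L -powRrM mulrN powRN sL mulfK //.
  by rewrite gt_eqF.
have s1 : 0 < s - 1 by rewrite subr_gt0 (lt_le_trans _ s5) // ltr1n.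
have nm2 : (n%:R + m%:R) / n%:R <= 2 :> R.
  by rewrite ler_pdivrMr // mulr_natl mulr2n lerD2l ler_nat.
have -> : 1 / ((1 - s^-1) * L) = (s * (s - 1))^-1.
  by rewrite sL; field; rewrite !gt_eqF.
apply: (@le_trans _ _ (2 * (s * (s - 1))^-1 + (2 * s)^-1)).
  apply: lerD; first by apply: ler_wpM2r nm2; rewrite invr_ge0 ltW // mulr_gt0.
  by rewrite lef_pV2 ?posrE ?powR_gt0 ?mulr_gt0 // twice_le_powR2.
rewrite -subr_ge0 (_ : _ - _ = (s - 5) / (2 * s * (s - 1))).
  by rewrite divr_ge0 ?subr_ge0 // ltW // !mulr_gt0.
by field; rewrite !gt_eqF.
Qed.

Theorem theorem1 (R : realType) :
  (forall n m : nat, (2 ^ 25 <= m)%N -> (m <= n)%N ->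
     (poset_ramsey (boolean_lattice m) (boolean_lattice n))%:R
       <= n%:R * (m%:R - (1 - 2 / Num.sqrt (log2 m%:R)) * log2 m%:R) :> R)
  /\
  (forall (n m : nat) (eps : R), (0 < m)%N -> (m <= n)%N ->
     0 < eps -> eps < 1 ->
     (n%:R + m%:R) / n%:R * (1 / ((1 - eps) * log2 m%:R)) + m%:R `^ (- eps)
       <= eps ->
     (poset_ramsey (boolean_lattice m) (boolean_lattice n))%:R
       <= n%:R * (m%:R - (1 - eps) ^+ 2 * log2 m%:R) :> R).
Proof.
split=> [n m m25 mn|n m eps]; last exact: poset_ramsey_lattices_eps.
have m0 : (0 < m)%N by apply: leq_trans m25; rewrite expn_gt0.
have s5 := sqrt_log2_ge5 R m25; have := sqrt_eps_condition R m25 mn => /=.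
move: s5; set s := Num.sqrt _ => s5 cond.
have s0 : 0 < s by apply: lt_le_trans s5.
have eps1 : s^-1 < 1 by rewrite invf_lt1 // (lt_le_trans _ s5) // ltr1n.
apply: le_trans (poset_ramsey_lattices_eps m0 mn _ eps1 cond) _; first by rewrite invr_gt0.
rewrite ler_wpM2l // lerD2l lerN2 ler_wpM2r //; first by rewrite ltW // -sqrtr_gt0.
(* (1 - eps)^2 exceeds 1 - 2 eps by eps^2. *)
by rewrite -subr_ge0 (_ : _ - _ = s^-1 ^+ 2) ?sqr_ge0 //; ring.
Qed.
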